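(* Suppose a group $G$ acts without inversions on a simplicial tree $T$. If $g\in G$ is well-aligned then $\operatorname{scl}(g)\geq 1/12$.
   Context: For $g\in G$, let $|g|=\min_{x\in T}d(x,gx)$ (edges have length one). $g$ is hyperbolic if $|g|>0$; then the set $T_g$ of points attaining the minimum is a line, the axis of $g$. A hyperbolic element $g\in G$ is well-aligned if there does not exist $h\in G$ such that $ghgh^{-1}$ fixes an edge of $T_g$. Stable commutator length in a group $G$: for $g\in[G,G]$, $\operatorname{scl}(g)=\lim_{n\to\infty}\operatorname{cl}(g^n)/n$, where $\operatorname{cl}$ is the least number of commutators whose product is the given element; if $g^k\in[G,G]$ for some $k\ge1$, $\operatorname{scl}(g)=\operatorname{scl}(g^k)/k$; otherwise $\operatorname{scl}(g)=\infty$. *)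

(* Defs.v *)
From mathcomp Require Import all_boot all_order all_algebra.
From mathcomp Require Import all_classical all_reals all_analysis.
Set Implicit Arguments.
Unset Strict Implicit.
Unset Printing Implicit Defensive.
Import Order.TTheory GRing.Theory Num.Theory numFieldNormedType.Exports.
Local Open Scope classical_set_scope.
Local Open Scope ring_scope.

(* A simplicial tree is given by its vertices and its adjacency relation: a
   nonempty connected simple graph without simple closed paths. A [ucycle]
   of length 2 merely traverses an edge back and forth. *)
Record is_tree (V : eqType) (adj : rel V) : Prop := IsTree {
  tree_nonempty : exists v : V, True;
  tree_sym : symmetric adj;
  tree_irr : irreflexive adj;
  tree_connected : forall u v, exists2 p, path adj u p & last u p = v;
  tree_acyclic : forall c, ucycle adj c -> (size c < 3)%N
}.

Record is_tree_action (G : groupType) (V : eqType) (adj : rel V)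
    (act : G -> V -> V) : Prop := IsTreeAction {
  act_one : forall v, act 1%g v = v;
  act_mul : forall g h v, act (g * h)%g v = act g (act h v);
  act_adj : forall g u v, adj (act g u) (act g v) = adj u v
}.

Definition without_inversions (G : groupType) (V : eqType) (adj : rel V)
    (act : G -> V -> V) : Prop :=
  forall g u v, adj u v -> ~ (act g u = v /\ act g v = u).

Section Realization.
Variables (R : realType) (V : eqType) (adj : rel V).

(* Points of the geometric realization are given by their barycentric
   coordinates, as functions V -> R. For u = v this is the vertex v. *)
Definition segment (u v : V) : set (V -> R) :=
  [set x | exists2 t, 0 <= t <= 1 &
             x = fun w => (1 - t) * (w == u)%:R + t * (w == v)%:R].

Definition realization : set (V -> R) :=
  [set x | exists u v, (u = v \/ adj u v) /\ segment u v x].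

(* [chain x y l]: some concatenation of finitely many straight segments, each
   inside one closed edge, joins x to y and has total length l. Within the
   edge {u, v}, of length one, the coordinate at v is an arc-length
   parameter. *)
Inductive chain : (V -> R) -> (V -> R) -> R -> Prop :=
| chain_nil x : chain x x 0
| chain_cons x y z u v l :
    adj u v -> segment u v x -> segment u v y -> chain y z l ->
    chain x z (`|x v - y v| + l).

Definition tree_dist (x y : V -> R) : R := inf [set l | chain x y l].

End Realization.

Section TreeAction.
Variables (R : realType) (G : groupType) (V : eqType) (adj : rel V).
Variable act : G -> V -> V.

(* The simplicial extension of the action to points. *)
Definition act_point (g : G) (x : V -> R) : V -> R :=
  fun w => x (act (g^-1)%g w).

Definition displacement (g : G) (x : V -> R) : R :=
  tree_dist adj x (act_point g x).

(* For an action without inversions on a tree this infimum is a minimum. *)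
Definition translation_length (g : G) : R :=
  inf [set displacement g x | x in @realization R V adj].

Definition hyperbolic (g : G) : Prop := 0 < translation_length g.

Definition axis (g : G) : set (V -> R) :=
  [set x | realization adj x /\ displacement g x = translation_length g].

Definition edge_of_axis (g : G) (u v : V) : Prop :=
  adj u v /\ @segment R V u v `<=` axis g.

Definition fixes_edge (g : G) (u v : V) : Prop := act g u = u /\ act g v = v.

Definition well_aligned (g : G) : Prop :=
  hyperbolic g /\
  ~ exists h u v, edge_of_axis g u v /\ fixes_edge (g * h * g * h^-1)%g u v.

End TreeAction.

Section Scl.
Variables (R : realType) (G : groupType).

Definition commutator_product (g : G) (n : nat) : Prop :=
  exists s : seq (G * G),
    size s = n /\ g = (\prod_(p <- s) [~ p.1, p.2])%g.

(* Inverses of commutators are commutators, so [G,G] consists of the products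
   of commutators. *)
Definition derived (g : G) : Prop := exists n, commutator_product g n.

(* Junk value 0 when P is empty. *)
Definition least (P : nat -> Prop) : nat :=
  if pselect (exists n, `[< P n >]) is left e then ex_minn e else 0%N.

Definition cl (g : G) : nat := least (commutator_product g).

Definition scl_derived (g : G) : R :=
  limn (fun n : nat => (cl (g ^+ n)%g)%:R / n%:R : R).

Definition derived_power (g : G) (k : nat) : Prop :=
  (0 < k)%N /\ derived (g ^+ k)%g.

(* scl_derived (g ^+ k) / k does not depend on the choice of k >= 1 with
   g ^+ k in [G,G]; the least one is used, which is 1 if g is in [G,G]. *)
Definition scl (g : G) : \bar R :=
  if pselect (exists k, derived_power g k) then
    (scl_derived (g ^+ least (derived_power g))%g / (least (derived_power g))%:R)%:E
  else +oo%E.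

End Scl.

(* Main.v *)
Require Import Defs.
From mathcomp Require Import all_boot all_order all_algebra.
From mathcomp Require Import all_classical all_reals all_analysis.
From mathcomp Require Import zify lra ring.
Set Implicit Arguments.
Unset Strict Implicit.
Unset Printing Implicit Defensive.
Import Order.TTheory GRing.Theory Num.Theory numFieldNormedType.Exports.
Local Open Scope ring_scope.

(** Every product of [m] commutators is bounded by about [12 * m] under a
    suitable counting function, while [g ^+ n] has value at least [n - 1].

    The counting function is of Brooks type. Let [s] be a fundamental domain of
    the axis of [g] that runs from the middle of an edge to the middle of the
    translated edge. For a path, take the largest number of non-overlapping
    copies of [s] (translates under the group) on it, where the path has to
    contain both end edges of a copy entirely, and subtract the same number for
    the reversed path ([signed_copies]). If a path is cut at a vertex, at most
    one copy is destroyed for either orientation, so the count is additive up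
    to 1 ([signed_copies_glue]).

    The sides of a triangle in a tree form a tripod; the two orientations of
    each leg cancel, and one cut on each of the three sides remains. So the
    signed count from a base point to its translate is a quasimorphism
    [counting] of defect 3 ([countingM]). A commutator then has value at most
    9, and a product of [m] commutators at most [12 * m + 3]
    ([counting_commutator_product]).

    The translates of [s] by powers of [g] tile the axis, so [g ^+ n] carries
    at least [n - 1] copies. A reversed copy on the axis, say by [k], gives an
    element of the form [g * h * g * h^-1] that fixes an edge of the axis: it
    fixes the middle of the edge by construction, and both ends because whole
    end edges are recorded. This is what being well-aligned excludes
    ([reversed_copy]). Hence [counting] is at least [n - 1] at [g ^+ n]; taking
    powers removes the additive constants, and [n <= 12 * m] whenever [g ^+ n]
    is a product of [m] commutators. Fekete's lemma ([subadditive_cvg]) makes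
    the limit in the definition of scl exist, so that this bound passes to it.

    The combinatorial axis is a ray of vertices obtained by translating a
    geodesic of least displacement ([periodic_ray_exists]). That its edges lie
    in the metric axis follows from the Busemann function of the ray: it is
    1-Lipschitz and grows by [L] under [g], so no point of the realization is
    moved by less than [L], whereas [g] moves the points of the ray along it by
    [L] ([edge_of_axis_ray]). *)

(** * Disjoint occurrences in a word *)

Section Packing.
Variables (T : Type) (P : seq T -> Prop).

(** Pairwise disjoint factors of a word that satisfy [P] are chosen while the
    word is read from left to right, so that concatenation and cutting are
    handled by induction. *)
Inductive packs : seq T -> nat -> Prop :=
| packs_nil : packs [::] 0
| packs_skip x w n : packs w n -> packs (x :: w) n
| packs_take u w n : P u -> packs w n -> packs (u ++ w) n.+1.

Lemma packs0 w : packs w 0.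
Proof. by elim: w => [|x w IHw]; constructor. Qed.

Lemma packs_catl u w n : packs w n -> packs (u ++ w) n.
Proof. by move=> pw; elim: u => //= x u IHu; constructor. Qed.

Lemma packs_cat w1 w2 n1 n2 :
  packs w1 n1 -> packs w2 n2 -> packs (w1 ++ w2) (n1 + n2).
Proof.
move=> p1 p2; elim: p1 => [//|x w n _ IHw|u w n Pu _ IHw] /=.
  exact: packs_skip.
by rewrite -catA addSn; apply: packs_take.
Qed.

Lemma packs_factor w n :
  packs w n -> (0 < n)%N -> exists a u b, w = a ++ u ++ b /\ P u.
Proof.
elim=> [//|x w' n' _ IHw /IHw [a [u [b [-> Pu]]]]|u w' n' Pu _ _ _].
  by exists (x :: a), u, b.
by exists [::], u, w'.
Qed.

Lemma cat_overlap (u w w1 w2 : seq T) : u ++ w = w1 ++ w2 ->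
  (size w1 <= size u)%N -> exists2 r, u = w1 ++ r & w2 = r ++ w.
Proof.
elim: w1 u => [|x w1 IHw] [|y u] //= E le_u; first by exists [::].
  by exists (y :: u).
by case: E => -> /IHw [//|r -> ->]; exists r.
Qed.

(** Cutting a word loses at most the one factor that straddles the cut; if a
    single letter [m] is removed at the cut, then still only one factor is
    lost, since disjoint factors cannot both contain that letter. *)
Lemma packs_split w1 m w2 n : (size m <= 1)%N -> packs (w1 ++ m ++ w2) n ->
  exists n1 n2, [/\ packs w1 n1, packs w2 n2 & (n <= (n1 + n2).+1)%N].
Proof.
move=> sm pw;
move Ew: (w1 ++ m ++ w2) pw => w pw; move/esym: Ew.
elim: pw w1 m sm => [|x w' n' pw' IHw|u w' n' Pu pw' IHw] w1 m sm Ew.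
- by exists 0%N, 0%N; split=> //; apply: packs0.
- case: w1 Ew => [|y w1] /= Ew.
    case: m sm Ew => [|y m] /= sm Ew.
      exists 0%N, n'; split=> //; first exact: packs_nil.
      by rewrite -Ew; apply: packs_skip.
    case: m sm Ew => // _ [_ <-].
    by exists 0%N, n'; split=> //; apply: packs_nil.
  case: Ew => <- /IHw [//|n1 [n2 [p1 p2 le_n]]].
  by exists n1, n2; split=> //; apply: packs_skip.
have [le_u | lt_u] := leqP (size u) (size w1).
  have [r Er /esym Ew'] := cat_overlap (esym Ew) le_u.
  have [n1 [n2 [p1 p2 le_n]]] := IHw _ _ sm (esym Ew').
  by exists n1.+1, n2; split=> //; rewrite Er; apply: packs_take.
have [r Eu Er] := cat_overlap Ew (ltnW lt_u).
exists 0%N, n'; split=> //; first exact: packs0.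
have le_m : (size m <= size r)%N.
  by rewrite (leq_trans sm) // -(ltn_add2l (size w1)) addn0 -size_cat -Eu.
have [r' _ ->] := cat_overlap (esym Er) le_m.
exact: packs_catl.
Qed.

Hypothesis P_nonempty : forall u, P u -> (0 < size u)%N.

Lemma packs_size w n : packs w n -> (n <= size w)%N.
Proof.
elim=> [//|x w' n' _ IHw|u w' n' /P_nonempty u_gt0 _ IHw] /=; first exact: leqW.
by rewrite size_cat -add1n leq_add.
Qed.

Definition packing w : nat :=
  \max_(n < (size w).+1 | `[< packs w n >]) n.

Lemma packing_packs w : packs w (packing w).
Proof.
rewrite /packing; elim/big_ind: _ => [|m n pm pn|n /asboolP //].
  exact: packs0.
by case: leqP.
Qed.

Lemma packing_max w n : packs w n -> (n <= packing w)%N.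
Proof.
move=> pw; have lt_n : (n < (size w).+1)%N by rewrite ltnS packs_size.
by apply: (bigop.bigmax_sup (Ordinal lt_n)) => //; apply/asboolP.
Qed.

Lemma packing_cut w1 m w2 : (size m <= 1)%N ->
  (packing w1 + packing w2 <= packing (w1 ++ m ++ w2)
     <= (packing w1 + packing w2).+1)%N.
Proof.
move=> sm; apply/andP; split.
  apply: packing_max; apply: packs_cat; first exact: packing_packs.
  by apply: packs_catl; exact: packing_packs.
have [n1 [n2 [p1 p2 le_n]]] := packs_split sm (packing_packs (w1 ++ m ++ w2)).
rewrite (leq_trans le_n) // ltnS.
by apply: leq_add; apply: packing_max.
Qed.

End Packing.

(** * Turns of a path *)

(** A copy of a fundamental domain that runs between the middles of two edges
    is determined by its turns: consecutive copies along an axis share an edge,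
    but no turn. So disjoint copies are disjoint factors of the word of turns.
    *)
Fixpoint turns (T : Type) (s : seq T) : seq (T * T * T) :=
  if s is x :: t then
    (if t is y :: z :: _ then (x, y, z) :: turns t else [::])
  else [::].

Section Turns.
Variable T : Type.
Implicit Types (s p q : seq T) (a b o : T).

Lemma turns_cat2 p a b q :
  turns (p ++ [:: a, b & q]) = turns (p ++ [:: a; b]) ++ turns [:: a, b & q].
Proof. by elim: p => [//|x [|y [|z p]] //= ->]. Qed.

(** Cutting at a vertex removes the turn at this vertex, if there is one. *)
Lemma turns_glue p o q : exists2 m, (size m <= 1)%N &
  turns (p ++ o :: q) = turns (rcons p o) ++ m ++ turns (o :: q).
Proof.
case: q => [|b q]; first by exists [::]; rewrite // cats1 cats0.
case/lastP: p => [|p a]; first by exists [::].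
exists [:: (a, o, b)] => //.
by rewrite cat_rcons turns_cat2 -(cats1 (rcons p a)) cat_rcons.
Qed.

Lemma turns_rev s :
  turns (rev s) = rev [seq (t.2, t.1.2, t.1.1) | t <- turns s].
Proof.
elim: s => [//|x [|y [|z s]] // IHs].
have -> : turns [:: x, y, z & s] = (x, y, z) :: turns [:: y, z & s] by [].
by rewrite map_cons [RHS]rev_cons -IHs !rev_cons -!cats1 -!catA turns_cat2 catA.
Qed.

Lemma turns_map (S : Type) (f : T -> S) s :
  turns (map f s) = [seq (f t.1.1, f t.1.2, f t.2) | t <- turns s].
Proof. by elim: s => [//|x [|y [|z s]] //= ->]. Qed.

Lemma size_turns s : size (turns s) = (size s - 2)%N.
Proof. by elim: s => [//|x [|y [|z s]] //= ->]; rewrite !subSS !subn0. Qed.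

End Turns.

(** * Geodesics in a tree *)

Definition nonbacktracking (V : eqType) (s : seq V) : bool :=
  all (fun t => t.1.1 != t.2) (turns s).

Section Tree.
Variables (V : eqType) (adj : rel V).
Hypothesis treeT : is_tree adj.
Implicit Types (s p q : seq V) (a b c v x : V).

Lemma uniq_nonbacktracking s : uniq s -> nonbacktracking s.
Proof.
rewrite /nonbacktracking.
elim: s => [//|x [|y [|z s]] // IHs] Us.
have /andP [x_s Us'] := Us; move: x_s; rewrite !inE !negb_or => /and3P [_ xz _].
have -> : turns [:: x, y, z & s] = (x, y, z) :: turns [:: y, z & s] by [].
by rewrite [all _ _]/= xz; apply: IHs.
Qed.

(** The first return of a nonbacktracking path to a vertex would close up a
    simple cycle. *)
Lemma nonbacktracking_uniq s : sorted adj s -> nonbacktracking s -> uniq s.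
Proof.
rewrite /nonbacktracking; elim: s => [//|x [//|y s] IHs] ss nb.
have /andP [xy] := ss; rewrite -/(path adj y s) => {ss} ps.
have Us : uniq (y :: s).
  by apply: IHs => //; case: s nb {ps} => [|z s] //= /andP [].
rewrite cons_uniq Us andbT; apply/negP; rewrite inE => /orP [/eqP Exy | xs].
  by rewrite Exy (tree_irr treeT) in xy.
case/path.splitP: xs ps Us nb => p1 p2 ps Us nb.
have : ucycle adj (x :: y :: p1).
  apply/andP; split.
    rewrite /= xy rcons_path.
    by move: ps; rewrite cat_path rcons_path => /andP [/andP [-> ->]].
  move: Us; rewrite -cat_cons -rcons_cons cat_uniq rcons_uniq.
  by case/andP.
move/(tree_acyclic treeT); case: p1 nb {ps Us} => [|z p1] //=.
by rewrite eqxx.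
Qed.

Lemma sorted_rev s : sorted adj s -> sorted adj (rev s).
Proof.
rewrite rev_sorted; apply: sub_sorted => x y.
by rewrite (tree_sym treeT).
Qed.

Lemma sorted_glue p v q :
  sorted adj (p ++ v :: q) = sorted adj (rcons p v) && sorted adj (v :: q).
Proof.
by case: p => [//|x p] /=; rewrite cat_path rcons_path /= andbA.
Qed.

Lemma common_prefix x p q : exists u v p' q',
  [/\ x :: p = u ++ v :: p', x :: q = u ++ v :: q' &
      forall a p1 q1, p' = a :: p1 -> q' <> a :: q1].
Proof.
elim: p x q => [|y p IHp] x q; first by exists [::], x, [::], q; split.
case: q => [|z q]; first by exists [::], x, (y :: p), [::]; split.
have [Eyz|yz] := eqVneq y z; last first.
  exists [::], x, (y :: p), (z :: q); split=> // a p1 q1 [ <- _] [Ezy _].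
  by rewrite Ezy eqxx in yz.
have [u [v [p' [q' [-> Eq H]]]]] := IHp y q; rewrite -Eyz Eq.
by exists (x :: u), v, p', q'; split.
Qed.

Definition simple s : bool := sorted adj s && uniq s.

Lemma simple_rev s : simple s -> simple (rev s).
Proof. by case/andP=> ss us; rewrite /simple sorted_rev // rev_uniq. Qed.

(** Two simple paths that start at the same vertex [x] agree up to a vertex
    [v]; leaving the common part out, they form a path that does not backtrack
    at [v], hence is simple. *)
Lemma tripod x p q : simple (x :: p) -> simple (x :: q) ->
  exists u v p' q', [/\ x :: p = u ++ v :: p', x :: q = u ++ v :: q' &
                       simple (rev p' ++ v :: q')].
Proof.
move=> sp sq; have [u [v [p' [q' [Ep Eq H]]]]] := common_prefix x p q.
exists u, v, p', q'; split=> //.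
have cut r : simple (u ++ v :: r) -> simple (v :: r).
  rewrite /simple sorted_glue cat_uniq.
  by move=> /andP [/andP [_ ->] /and3P [_ _ ->]].
have {}sp : simple (v :: p') by apply: cut; rewrite -Ep.
have {}sq : simple (v :: q') by apply: cut; rewrite -Eq.
have ss : sorted adj (rev p' ++ v :: q').
  rewrite sorted_glue -rev_cons sorted_rev; first by case/andP: sq.
  by case/andP: sp.
rewrite /simple ss; apply: nonbacktracking_uniq => //.
have /andP [_ /uniq_nonbacktracking nq] := sq.
have /simple_rev/andP [_ /uniq_nonbacktracking] := sp.
case: q' H {sq ss Eq} nq => [|c q'] H nq np; first by rewrite cats1 -rev_cons.
case: p' H {sp Ep} np => [//|a p'] H np.
rewrite rev_cons cat_rcons /nonbacktracking turns_cat2 all_cat.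
rewrite -cat_rcons cats1 -!rev_cons; apply/andP; split=> //.
rewrite [turns _]/= [all _ _]/=; apply/andP; split=> //=.
by apply/eqP=> Eac; apply: (H a p' q'); rewrite ?Eac.
Qed.

Definition geodesic a b s : Prop :=
  [/\ simple s, ohead s = Some a & ohead (rev s) = Some b].

Lemma geodesic_exists a b : exists s, geodesic a b s.
Proof.
have [p pp Ep] := tree_connected treeT a b.
case/shortenP: pp Ep => p' pp' Up' _ Ep'.
exists (a :: p'); split=> //; first exact/andP.
by rewrite lastI rev_rcons /= Ep'.
Qed.

Lemma geodesic_sym a b s : geodesic a b s -> geodesic b a (rev s).
Proof. by case=> ss ha hb; split; rewrite ?revK //; apply: simple_rev. Qed.

Lemma geodesic_tripod a b c s t : geodesic b a s -> geodesic b c t ->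
  exists u v p q, [/\ s = u ++ v :: p, t = u ++ v :: q &
                     geodesic a c (rev p ++ v :: q)].
Proof.
case: s => [|x s] [ss //= [Ex]]; case: t => [|y t] ha [st //= [Ey]] hc.
rewrite {}Ex {}Ey in ss ha st hc *.
have [u [v [p [q [Es Et spq]]]]] := tripod ss st.
exists u, v, p, q; split=> //; split=> //.
  rewrite -ha Es rev_cat rev_cons; case/lastP: p {Es ha spq} => [//|p z].
  by rewrite rev_rcons.
rewrite -hc Et !rev_cat rev_cons; case/lastP: q {Et hc spq} => [//|q z].
by rewrite rev_rcons.
Qed.

(** For [a = c] the tripod degenerates: a simple closed path is one vertex. *)
Lemma geodesic_unique a b s t : geodesic a b s -> geodesic a b t -> s = t.
Proof.
move=> gs gt; have [u [v [p [q [-> -> [/andP [_ U] h1 h2]]]]]] :=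
  geodesic_tripod gs gt.
suff: size (rev p ++ v :: q) = 1%N.
  by case/lastP: p U h1 h2 => [|p z]; case: q => [|w q] //=;
     rewrite ?rev_rcons ?size_cat /= ?addnS.
move: U h1 h2; case: (rev p ++ v :: q) => [//|x r] U /= [Ex].
case/lastP: r U => [//|r z] U; rewrite -rcons_cons rev_rcons => -[Eza].
by move: U; rewrite Ex Eza -rcons_cons rcons_uniq mem_head.
Qed.

Lemma geodesic_cons_exists a b : exists p, geodesic a b (a :: p).
Proof.
have [[|x s] [ss h1 h2]] := geodesic_exists a b; first by [].
by exists s; case: h1 => Ex; rewrite -Ex; split=> //; rewrite Ex.
Qed.

End Tree.

Section Distance.
Variables (V : eqType) (adj : rel V).
Hypothesis treeT : is_tree adj.
Implicit Types (s p : seq V) (a b c : V).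

Definition geo a b : seq V := sval (cid (geodesic_exists treeT a b)).

Lemma geoP a b : geodesic adj a b (geo a b).
Proof. exact: svalP (cid (geodesic_exists treeT a b)). Qed.

Lemma geo_eq a b s : geodesic adj a b s -> geo a b = s.
Proof. exact/(geodesic_unique treeT)/geoP. Qed.

Definition dist a b : nat := (size (geo a b)).-1.

Lemma dist_path a b : exists p,
  [/\ path adj a p, last a p = b & size p = dist a b].
Proof.
have [p gp] := geodesic_cons_exists treeT a b.
exists p; rewrite /dist (geo_eq gp).
case: gp => /andP [pp _] _ gb; split=> //.
by move: gb; rewrite lastI rev_rcons => -[].
Qed.

Lemma dist_simple a p : simple adj (a :: p) -> dist a (last a p) = size p.
Proof.
move=> sp; rewrite /dist (@geo_eq _ _ (a :: p)) //.
by split; rewrite // lastI rev_rcons.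
Qed.

Lemma dist_le a p : path adj a p -> (dist a (last a p) <= size p)%N.
Proof.
case/shortenP=> q pq Uq sub_qp; rewrite dist_simple; last exact/andP.
by apply: uniq_leq_size sub_qp; case/andP: Uq.
Qed.

Lemma dist_triangle a b c : (dist a c <= dist a b + dist b c)%N.
Proof.
have [p [pp Ep <-]] := dist_path a b; have [q [pq Eq <-]] := dist_path b c.
by rewrite -size_cat -Eq -Ep -last_cat dist_le // cat_path pp Ep.
Qed.

Lemma dist_adj a b : adj a b -> (dist a b <= 1)%N.
Proof. by move=> ab; apply: (@dist_le a [:: b]); rewrite /= ab. Qed.

End Distance.

(** * The counting function of a segment *)

Section Counting.
Variables (G : groupType) (V : eqType) (adj : rel V) (act : G -> V -> V).
Hypotheses (treeT : is_tree adj) (actT : is_tree_action adj act).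
Implicit Types (k l : G) (s p : seq V) (a b c v : V).

Lemma actK k : cancel (act k) (act k^-1%g).
Proof. by move=> v; rewrite -(act_mul actT) mulVg (act_one actT). Qed.

Lemma act_inj k : injective (act k).
Proof. exact: can_inj (actK k). Qed.

Lemma sorted_act k s : sorted adj (map (act k) s) = sorted adj s.
Proof.
by rewrite sorted_map; apply: eq_sorted => x y; apply: (act_adj actT).
Qed.

Lemma geodesic_act k a b s :
  geodesic adj a b s -> geodesic adj (act k a) (act k b) (map (act k) s).
Proof.
case=> /andP [ss us] ha hb; split.
- by rewrite /simple sorted_act map_inj_uniq ?ss //; apply: act_inj.
- by case: s ha {ss us hb} => //= x s [->].
- by rewrite -map_rev; case: (rev s) hb => //= x r [->].
Qed.

Lemma dist_act k a b : dist treeT (act k a) (act k b) = dist treeT a b.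
Proof.
by rewrite /dist (geo_eq treeT (geodesic_act k (geoP treeT a b))) size_map.
Qed.

Variable segm : seq V.
Hypothesis size_segm : (2 < size segm)%N.

Definition is_copy (u : seq (V * V * V)) : Prop :=
  exists k, u = turns (map (act k) segm).

Lemma is_copy_nonempty u : is_copy u -> (0 < size u)%N.
Proof. by case=> k ->; rewrite size_turns size_map subn_gt0. Qed.

Definition copies s : nat := packing is_copy (turns s).

Lemma copies_act k s : copies (map (act k) s) = copies s.
Proof.
have le k' s' : (copies s' <= copies (map (act k') s'))%N.
  apply: (packing_max is_copy_nonempty); rewrite turns_map.
  rewrite /copies; move: (packing_packs is_copy (turns s')).
  elim=> [|t w n _ IHw|u w n [l ->] _ IHw].
  - exact: packs_nil.
  - exact: packs_skip.
  rewrite map_cat; apply: packs_take => //; exists (k' * l)%g.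
  rewrite -turns_map -map_comp; congr turns; apply: eq_map => v /=.
  by rewrite (act_mul actT).
apply/eqP; rewrite eqn_leq le andbT.
rewrite (leq_trans (le k^-1%g _)) // -map_comp (eq_map (g := id)) ?map_id //.
exact: actK.
Qed.

(** A copy of the segment on [rev s] is a reversed copy on [s]. *)
Definition signed_copies s : int := (copies s)%:Z - (copies (rev s))%:Z.

Lemma signed_copies_rev s : signed_copies (rev s) = - signed_copies s.
Proof. by rewrite /signed_copies revK opprB. Qed.

Lemma signed_copies_glue p v q :
  `|signed_copies (p ++ v :: q)
    - signed_copies (rcons p v) - signed_copies (v :: q)| <= 1.
Proof.
have glue p' q' : (copies (rcons p' v) + copies (v :: q') <=
    copies (p' ++ v :: q') <= (copies (rcons p' v) + copies (v :: q')).+1)%N.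
  rewrite /copies; have [m sm ->] := turns_glue p' v q'.
  exact: packing_cut is_copy_nonempty _ _ _ sm.
move: (glue p q) (glue (rev q) (rev p)); rewrite /signed_copies.
rewrite rev_cat rev_cons cat_rcons rev_rcons.
lia.
Qed.

Definition signed_between a b : int := signed_copies (geo treeT a b).

Lemma signed_between_act k a b :
  signed_between (act k a) (act k b) = signed_between a b.
Proof.
rewrite /signed_between (geo_eq treeT (geodesic_act k (geoP treeT a b))).
by rewrite /signed_copies -map_rev !copies_act.
Qed.

(** The legs of the tripod spanned by [a], [b], [c] contribute to the three
    sides with cancelling signs, and each side has one cut point. *)
Lemma signed_between_tripod a b c :
  `|signed_between a c - signed_between a b - signed_between b c| <= 3.
Proof.
have [u [v [p [q [Ea Ec Eac]]]]] :=
  geodesic_tripod treeT (geoP treeT b a) (geoP treeT b c).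
have Eab := geodesic_sym treeT (geoP treeT b a).
rewrite /signed_between (geo_eq treeT Eac) (geo_eq treeT Eab) Ec.
rewrite signed_copies_rev Ea.
have := signed_copies_glue u v p; have := signed_copies_glue u v q.
have := signed_copies_glue (rev p) v q.
rewrite -rev_cons signed_copies_rev; lia.
Qed.

Variable x0 : V.

Definition counting k : int := signed_between x0 (act k x0).

Lemma countingM k l : `|counting (k * l)%g - counting k - counting l| <= 3.
Proof.
rewrite /counting (act_mul actT) -(signed_between_act k x0 (act l x0)).
exact: signed_between_tripod.
Qed.

(** The defect enters three times, when [k * l = l * k * [~ k, l]] is
    expanded. *)
Lemma counting_commg k l : `|counting [~ k, l]%g| <= 9.
Proof.
have := countingM (l * k) [~ k, l].
have := countingM l k; have := countingM k l.
by rewrite -commgC; lia.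
Qed.

(** Each commutator contributes 9 by itself and 3 for being multiplied on. *)
Lemma counting_commutator_product k n :
  commutator_product k n -> `|counting k| <= 12 * n%:Z + 3.
Proof.
case=> s [<- ->] {k n}; elim: s => [|[k l] s IHs] /=.
  have le3 : `|counting 1%g| <= 3 by have := countingM 1 1; rewrite mulg1; lia.
  by rewrite big_nil; apply: (le_trans le3); lia.
rewrite big_cons /=.
have le12 x : `|counting ([~ k, l] * x)%g| <= `|counting x| + 12.
  have aux (a b c : int) : `|a| <= 9 -> `|c - a - b| <= 3 -> `|c| <= `|b| + 12.
    by lia.
  exact: aux (counting_commg k l) (countingM _ x).
apply: (le_trans (le12 _)).
have aux (a : int) n : a <= 12 * n%:Z + 3 -> a + 12 <= 12 * n.+1%:Z + 3 by lia.
exact: aux IHs.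
Qed.

End Counting.

(** * The axis of a fixed point free automorphism *)

Lemma turns_iota m n :
  turns (iota m n) = [seq (i, i.+1, i.+2) | i <- iota m (n - 2)].
Proof.
elim: n m => [|n IHn] m //; case: n IHn => [|[|n]] IHn //.
have -> : turns (iota m n.+3) = (m, m.+1, m.+2) :: turns (iota m.+1 n.+2) by [].
by rewrite IHn !subSS !subn0.
Qed.

Section Ray.
Variables (V : eqType) (adj : rel V) (A : nat -> V).
Hypothesis treeT : is_tree adj.
Hypothesis A_adj : forall i, adj (A i) (A i.+1).
Hypothesis A_nonbacktracking : forall i, A i != A i.+2.

Lemma ray_path m n : path adj (A m) (map A (iota m.+1 n)).
Proof. by elim: n m => [//|n IHn] m /=; rewrite A_adj IHn. Qed.

Lemma ray_simple m n : simple adj (map A (iota m n.+1)).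
Proof.
have ss : sorted adj (map A (iota m n.+1)) by apply: ray_path.
rewrite /simple ss; apply: (nonbacktracking_uniq treeT ss).
rewrite /nonbacktracking turns_map turns_iota -map_comp all_map.
by apply/allP=> i _ /=.
Qed.

Lemma last_ray m n : last (A m) (map A (iota m.+1 n)) = A (m + n)%N.
Proof.
rewrite last_map; congr A.
by elim: n m => [|n IHn] m; rewrite ?addn0 //= IHn addSnnS.
Qed.

Lemma ray_geodesic m n : geodesic adj (A m) (A (m + n)%N) (map A (iota m n.+1)).
Proof.
split; rewrite ?ray_simple //.
have -> : map A (iota m n.+1) = A m :: map A (iota m.+1 n) by [].
by rewrite lastI rev_rcons last_ray.
Qed.

Lemma dist_ray m n : dist treeT (A m) (A (m + n)%N) = n.
Proof.
by rewrite /dist (geo_eq treeT (ray_geodesic m n)) size_map size_iota.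
Qed.

End Ray.

Section Axis.
Variables (G : groupType) (V : eqType) (adj : rel V) (act : G -> V -> V).
Hypotheses (treeT : is_tree adj) (actT : is_tree_action adj act).
Hypothesis noinv : without_inversions adj act.

(** The vertices of a half-line of the axis of [g], in the direction in which
    [g] translates. *)
Record periodic_ray (g : G) (L : nat) (A : nat -> V) : Prop := PeriodicRay {
  period_gt0 : (0 < L)%N;
  ray_adj : forall i, adj (A i) (A i.+1);
  ray_nonbacktracking : forall i, A i != A i.+2;
  ray_shift : forall i, A (i + L)%N = act g (A i)
}.

(** Take a vertex [v] that is moved by a least distance [L]. The translates of
    the geodesic from [v] to [act g v] fit together without backtracking:
    backtracking would exhibit a vertex that is moved less, or an inverted
    edge when [L] is 1. *)
Lemma periodic_ray_exists (g : G) : (forall v, act g v <> v) ->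
  exists L A, periodic_ray g L A.
Proof.
move=> nofix; have [v1 _] := tree_nonempty treeT.
have exL : exists n, `[< exists v, dist treeT v (act g v) = n >].
  by exists (dist treeT v1 (act g v1)); apply/asboolP; exists v1.
case: (ex_minnP exL) => L /asboolP [v EL] minL.
have {}minL w : (L <= dist treeT w (act g w))%N.
  by apply: minL; apply/asboolP; exists w.
have [p gp] := geodesic_cons_exists treeT v (act g v).
have sz_p : size p = L by rewrite -EL /dist (geo_eq treeT gp).
have [/andP [pp Up] _ _] := gp.
have lp : last v p = act g v.
  by case: gp => _ _; rewrite lastI rev_rcons => -[].
have L_gt0 : (0 < L)%N.
  rewrite -sz_p lt0n size_eq0; apply/eqP=> p0.
  by apply: (nofix v); rewrite -lp p0.
pose A i := iter (i %/ L) (act g) (nth v (v :: p) (i %% L)).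
have EA q r : (r <= L)%N ->
    A (q * L + r)%N = iter q (act g) (nth v (v :: p) r).
  rewrite leq_eqVlt /A => /orP [/eqP -> | lt_r].
    rewrite -mulSnr mulnK // modnMl iterSr [nth _ _ 0]/= -lp; congr iter.
    by rewrite -nth_last -sz_p; case: (p).
  by rewrite divnMDl // divn_small // addn0 modnMDl modn_small.
have iter_inj q : injective (iter q (act g)).
  by elim: q => [//|q IHq] x y /= /(act_inj actT) /IHq.
have iter_adj q x y : adj (iter q (act g) x) (iter q (act g) y) = adj x y.
  by elim: q => //= q; rewrite (act_adj actT).
exists L, A; split=> // i; last first.
- by rewrite {1}/A divnDr // divnn L_gt0 addn1 modnDr.
- rewrite (divn_eq i L); move: (i %/ L)%N (i %% L)%N (ltn_pmod i L_gt0) => q r lt_r.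
  rewrite EA; last exact: ltnW.
  have [le_r | gt_r] := leqP r.+2 L.
    rewrite -addnS -addnS EA // (inj_eq (iter_inj q)) nth_uniq //=; lia.
  have -> : (q * L + r).+2 = (q.+1 * L + 1)%N by lia.
  rewrite EA // iterSr (inj_eq (iter_inj q)).
  have {gt_r lt_r} -> : r = L.-1 by lia.
  apply/eqP=> E.
  case: p sz_p lp pp Up E {gp EA A} => [|y p] sz_p lp pp Up E.
    by rewrite -sz_p in L_gt0.
  case/lastP: p sz_p lp pp Up E => [|p z] sz_p lp pp Up E.
    apply: (@noinv g v y); first by case/andP: pp.
    by split; [rewrite -lp | rewrite -sz_p in E].
  have := minL y; rewrite -[act g y]/(act g (nth v [:: v, y & rcons p z] 1)) -E.
  have -> : nth v [:: v, y & rcons p z] L.-1 = last y p.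
    rewrite -sz_p -[last y p]/(last v (y :: p)) -nth_last /= size_rcons.
    by rewrite -rcons_cons [in LHS]/= -rcons_cons nth_rcons /= ltnSn.
  rewrite leqNgt; apply/negP/negPn.
  move: pp; rewrite /= rcons_path => /and3P [_ py _].
  rewrite (leq_ltn_trans (dist_le treeT py)) // -sz_p /= size_rcons; lia.
rewrite (divn_eq i L); move: (i %/ L)%N (i %% L)%N (ltn_pmod i L_gt0) => q r lt_r.
rewrite -addnS !EA ?iter_adj //; last exact: ltnW.
by move/(pathP v): pp; apply; rewrite sz_p.
Qed.

End Axis.

(** * Displacements in the geometric realization *)

Section Points.
Variables (R : realType) (V : eqType) (adj : rel V).
Hypothesis treeT : is_tree adj.
Implicit Types (u v w : V) (t r : R) (x y z : V -> R) (phi : V -> R).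

Definition vertex u : V -> R := fun w => (w == u)%:R.

Definition point u v t : V -> R :=
  fun w => (1 - t) * (w == u)%:R + t * (w == v)%:R.

Lemma point0 u v : point u v 0 = vertex u.
Proof.
by apply/funext => w; rewrite /point /vertex subr0 mul1r mul0r addr0.
Qed.

Lemma point1 u v : point u v 1 = vertex v.
Proof.
by apply/funext => w; rewrite /point /vertex subrr mul0r mul1r add0r.
Qed.

Lemma pointxx u t : point u u t = vertex u.
Proof. by apply/funext => w; rewrite /point /vertex -mulrDl subrK mul1r. Qed.

Lemma point_end u v t : u != v -> point u v t v = t.
Proof.
by rewrite /point eqxx eq_sym => /negPf ->; rewrite mulr0 mulr1 add0r.
Qed.

Lemma point_segment u v t : 0 <= t <= 1 -> segment u v (point u v t).
Proof. by move=> t01; exists t. Qed.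

Lemma vertex_segmentl u v : segment u v (vertex u).
Proof. by exists 0; [rewrite lexx ler01 | rewrite -(point0 u v)]. Qed.

Lemma vertex_segmentr u v : segment u v (vertex v).
Proof. by exists 1; [rewrite lexx ler01 | rewrite -(point1 u v)]. Qed.

Lemma adj_neq u v : adj u v -> u != v.
Proof. by apply: contraTneq => ->; rewrite (tree_irr treeT). Qed.

Lemma chain_ge0 x y l : chain adj x y l -> 0 <= l.
Proof. by elim=> // {}x {}y z u v {}l _ _ _ _ le0l; rewrite addr_ge0. Qed.

Lemma chain_trans x y z l m :
  chain adj x y l -> chain adj y z m -> exists n, chain adj x z n.
Proof.
move=> xy yz; elim: xy yz => [{}x|{}x y1 {}y u v {}l uv sx sy _ IH] yz.
  by exists m.
by have [n c] := IH yz; exists (`|x v - y1 v| + n); apply: chain_cons sx sy c.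
Qed.

Lemma chain_path u p : path adj u p ->
  exists l, chain adj (vertex u) (vertex (last u p)) l.
Proof.
elim: p u => [|v p IHp] u /=; first by exists 0; constructor.
case/andP=> uv /IHp [l c]; exists (`|vertex u v - vertex v v| + l).
exact: chain_cons uv (vertex_segmentl u v) (vertex_segmentr u v) c.
Qed.

Lemma realization_vertex x : realization adj x -> exists u,
  (exists l, chain adj x (vertex u) l) /\ (exists l, chain adj (vertex u) x l).
Proof.
case=> u [v [[<-|uv] sx]]; exists u.
  have -> : x = vertex u by case: sx => t _ ->; apply: pointxx.
  by split; exists 0; constructor.
have su := vertex_segmentl u v.
split.
  by exists (`|x v - vertex u v| + 0); apply: chain_cons uv sx su _; constructor.
by exists (`|vertex u v - x v| + 0); apply: chain_cons uv su sx _; constructor.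
Qed.

Lemma chain_exists x y :
  realization adj x -> realization adj y -> exists l, chain adj x y l.
Proof.
case/realization_vertex=> u [[l xu] _] /realization_vertex [v [_ [m vy]]].
have [p pp Ep] := tree_connected treeT u v.
have [n uv] := chain_path pp; rewrite Ep in uv.
by have [k xv] := chain_trans xu uv; apply: chain_trans xv vy.
Qed.

Lemma tree_dist_le x y l : chain adj x y l -> tree_dist adj x y <= l.
Proof. by move=> c; apply: ge_inf => //; exists 0 => m /chain_ge0. Qed.

Lemma tree_dist_ge0 x y : 0 <= tree_dist adj x y.
Proof.
have [[l c] | nc] := pselect (exists l, chain adj x y l).
  by apply: lb_le_inf; [exists l | move=> m /chain_ge0].
rewrite /tree_dist (_ : mkset _ = set0) ?inf0 //.
by apply/seteqP; split=> // l c; case: nc; exists l.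
Qed.

(** The graph of the affine extension of [phi] to the realization. It is a
    relation because a vertex is a [point] in many ways; all of them give the
    same value, by [interpolates_unique]. *)
Definition interpolates phi x r : Prop :=
  exists u v t, x = point u v t /\ r = (1 - t) * phi u + t * phi v.

(** The affine extension is linear in the barycentric coordinates, so it can
    be evaluated from the function [V -> R] alone. *)
Lemma sum_point (s : seq V) phi u v t : uniq s -> u \in s -> v \in s ->
  \sum_(w <- s) point u v t w * phi w = (1 - t) * phi u + t * phi v.
Proof.
move=> Us us vs.
have E a : a \in s -> \sum_(w <- s) (w == a)%:R * phi w = phi a.
  move=> sa; rewrite (bigD1_seq a) //= eqxx mul1r big1 ?addr0 // => w /negPf ->.
  by rewrite mul0r.
rewrite -(E u us) -(E v vs) !mulr_sumr -big_split /=.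
by apply: eq_bigr => w _; rewrite mulrDl !mulrA.
Qed.

Lemma interpolates_unique phi x r r' :
  interpolates phi x r -> interpolates phi x r' -> r = r'.
Proof.
case=> [u [v [t [-> ->]]]] [u' [v' [t' [E ->]]]].
pose s := undup [:: u; v; u'; v'].
rewrite -(@sum_point s) ?undup_uniq ?mem_undup ?inE ?eqxx ?orbT //.
rewrite E sum_point ?undup_uniq ?mem_undup ?inE ?eqxx ?orbT //.
Qed.

Lemma chain_lipschitz phi :
  (forall u v, adj u v -> `|phi u - phi v| <= 1) ->
  forall x y l rx ry, chain adj x y l ->
    interpolates phi x rx -> interpolates phi y ry -> `|rx - ry| <= l.
Proof.
move=> phi1 x y l rx ry c; elim: c rx ry => {x y l}
  [x | x y z u v l uv [t t01 Ex] [t' t01' Ey] _ IH] rx ry ix iy.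
  by rewrite (interpolates_unique ix iy) subrr normr0.
have iy' : interpolates phi y ((1 - t') * phi u + t' * phi v) by exists u, v, t'.
have ix' : interpolates phi x ((1 - t) * phi u + t * phi v) by exists u, v, t.
rewrite (interpolates_unique ix ix').
apply: le_trans (ler_distD ((1 - t') * phi u + t' * phi v) _ _) _.
apply: lerD (IH _ _ iy' iy).
rewrite (Ex : x = point u v t) (Ey : y = point u v t').
rewrite !point_end ?adj_neq //.
have -> : (1 - t) * phi u + t * phi v - ((1 - t') * phi u + t' * phi v)
   = (t - t') * (phi v - phi u) by ring.
by rewrite normrM ler_piMr // distrC phi1.
Qed.

End Points.

Section Displacement.
Variables (R : realType) (G : groupType) (V : eqType) (adj : rel V).
Variable act : G -> V -> V.
Hypotheses (treeT : is_tree adj) (actT : is_tree_action adj act).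
Implicit Types (g : G) (u v w : V) (x : V -> R).

Lemma act_point_point g u v (t : R) :
  act_point act g (point u v t) = point (act g u) (act g v) t.
Proof.
apply/funext => w; rewrite /act_point /point.
have E a : (act g^-1%g w == a) = (w == act g a).
  apply/eqP/eqP => [<-|->]; last exact: (actK actT).
  by rewrite -(act_mul actT) mulgV (act_one actT).
by rewrite !E.
Qed.

Lemma act_point_realization g x :
  realization adj x -> realization adj (act_point act g x).
Proof.
case=> u [v [uv [t t01 ->]]]; exists (act g u), (act g v); split.
  by case: uv => [->|uv]; [left | right; rewrite (act_adj actT)].
by rewrite -/(point u v t) act_point_point; apply: point_segment.
Qed.

Lemma displacement_ge0 g x : 0 <= displacement adj act g x.
Proof. exact: tree_dist_ge0. Qed.

Lemma translation_length_le g x :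
  realization adj x -> translation_length R adj act g <= displacement adj act g x.
Proof.
move=> rx; apply: ge_inf; last by exists x.
by exists 0 => _ [y _ <-]; apply: displacement_ge0.
Qed.

Lemma hyperbolic_no_fixed_vertex g v :
  hyperbolic R adj act g -> act g v <> v.
Proof.
rewrite /hyperbolic => hyp fixv.
have rv : realization adj (vertex R v).
  by exists v, v; split; [left | apply: vertex_segmentl].
have := translation_length_le g rv; rewrite leNgt => /negP; apply.
apply: le_lt_trans hyp; apply: tree_dist_le.
rewrite -{2}(point0 R v v) act_point_point fixv point0; exact: chain_nil.
Qed.

(** A function that is 1-Lipschitz on the vertices and that [g] raises by [L]
    certifies that every point is moved by at least [L]. *)
Lemma displacement_ge g (L : R) (phi : V -> R) :
  (forall u v, adj u v -> `|phi u - phi v| <= 1) ->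
  (forall v, phi (act g v) = phi v + L) ->
  forall x, realization adj x -> L <= displacement adj act g x.
Proof.
move=> phi1 phiL x rx; apply: lb_le_inf.
  exact: (chain_exists treeT rx (act_point_realization g rx)).
move=> l c; have [u [v [_ [t _ Ex]]]] := rx.
pose r := (1 - t) * phi u + t * phi v.
have ix : interpolates phi x r by exists u, v, t.
have iy : interpolates phi (act_point act g x) (r + L).
  exists (act g u), (act g v), t.
  split; first by rewrite (Ex : x = point u v t) act_point_point.
  by rewrite !phiL /r; ring.
have := chain_lipschitz treeT phi1 c ix iy.
by rewrite opprD addNKr normrN; apply: le_trans (ler_norm L).
Qed.

Variables (g : G) (L : nat) (A : nat -> V).
Hypothesis A_ray : periodic_ray adj act g L A.

Lemma ray_shiftn n : A (n.+1 * L)%N = act g (A (n * L)%N).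
Proof. by rewrite mulSnr (ray_shift A_ray). Qed.

(** The Busemann function of the end of the ray; the supremum is a limit, as
    the terms increase with [n]. *)
Definition busemann v : R :=
  sup [set (n * L)%:R - (dist treeT v (A (n * L)%N))%:R | n in setT]%classic.

Lemma busemann_ub v n :
  (n * L)%:R - (dist treeT v (A (n * L)%N))%:R <= busemann v.
Proof.
apply: ub_le_sup; last by exists n.
exists (dist treeT (A 0) v)%:R => _ [m _ <-].
rewrite lerBlDr -natrD ler_nat.
rewrite -{1}(dist_ray treeT (ray_adj A_ray) (ray_nonbacktracking A_ray) 0 (m * L)).
exact: dist_triangle.
Qed.

Lemma busemann_le v (b : R) :
  (forall n, (n * L)%:R - (dist treeT v (A (n * L)%N))%:R <= b) ->
  busemann v <= b.
Proof.
move=> ub; apply: ge_sup; last by move=> _ [n _ <-].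
by exists ((0 * L)%:R - (dist treeT v (A (0 * L)%N))%:R); exists 0%N.
Qed.

Lemma busemann_lipschitz u v : adj u v -> `|busemann u - busemann v| <= 1.
Proof.
have le a b : adj a b -> busemann a <= busemann b + 1.
  move=> ab; apply: busemann_le => n.
  rewrite (le_trans _ (lerD (busemann_ub b n) (lexx 1))) //.
  have := leq_trans (dist_triangle treeT b a (A (n * L)%N))
    (leq_add (dist_adj treeT (_ : adj b a)) (leqnn _)).
  rewrite (tree_sym treeT) -(ler_nat R) natrD => /(_ ab); lra.
move=> uv; rewrite ler_norml lerBlDr lerBrDr addrC lerBlDr.
by rewrite (le v u) ?(tree_sym treeT v) // [1 + _]addrC le.
Qed.

Lemma busemann_shift v : busemann (act g v) = busemann v + L%:R.
Proof.
have dS n : dist treeT (act g v) (A (n.+1 * L)%N) = dist treeT v (A (n * L)%N).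
  by rewrite ray_shiftn dist_act.
apply/eqP; rewrite eq_le; apply/andP; split.
  apply: busemann_le => n.
  apply: le_trans (lerD (busemann_ub v n) (lexx _)).
  have := dist_triangle treeT (act g v) (A (n * L)%N) (A (n.+1 * L)%N).
  rewrite {2}mulSnr (dist_ray treeT (ray_adj A_ray) (ray_nonbacktracking A_ray)).
  by rewrite dS -(ler_nat R) natrD; lra.
rewrite -lerBrDr; apply: busemann_le => n; rewrite lerBrDr.
by apply: le_trans (busemann_ub (act g v) n.+1); rewrite dS mulSnr natrD addrAC.
Qed.

Lemma chain_ray (t : R) i n : 0 <= t <= 1 ->
  chain adj (point (A i) (A i.+1) t) (point (A (i + n)%N) (A (i + n).+1) t) n%:R.
Proof.
case/andP=> t0 t1; elim: n i => [|n IHn] i.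
  by rewrite addn0; apply: chain_nil.
have adjA := ray_adj A_ray.
have st j : segment (A j) (A j.+1) (point (A j) (A j.+1) t).
  by apply: point_segment; rewrite t0.
have := chain_cons (adjA i.+1) (vertex_segmentl _ _ _) (st i.+1) (IHn i.+1).
move/(chain_cons (adjA i) (st i) (vertex_segmentr _ _ _)).
rewrite -{2}(point0 R (A i.+1) (A i.+2)) -{1}(point1 R (A i) (A i.+1)).
rewrite !point_end ?(adj_neq treeT) // sub0r normrN (ger0_norm t0).
by rewrite distrC ger0_norm ?subr_ge0 // addrA subrK nat1r addSnnS.
Qed.

(** The Busemann function bounds all displacements from below by [L], and
    [chain_ray] bounds those of the points of the ray from above by [L]. *)
Lemma edge_of_axis_ray i : edge_of_axis R adj act g (A i) (A i.+1).
Proof.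
have adjA := ray_adj A_ray; split=> // x sx; have [t t01 Ex] := sx.
have rx : realization adj x by exists (A i), (A i.+1); split=> //; right.
have lb := displacement_ge busemann_lipschitz busemann_shift.
split=> //; apply/eqP; rewrite eq_le translation_length_le // andbT.
apply: (@le_trans _ _ L%:R).
  apply: tree_dist_le.
  rewrite (Ex : x = point _ _ t) act_point_point -!(ray_shift A_ray) addSn.
  exact: chain_ray.
apply: lb_le_inf; first by exists (displacement adj act g x), x.
by move=> _ [y ry <-]; apply: lb.
Qed.

End Displacement.

(** * Reversed copies and powers *)

Section Power.
Variables (R : realType) (G : groupType) (V : eqType) (adj : rel V).
Variable act : G -> V -> V.
Hypotheses (treeT : is_tree adj) (actT : is_tree_action adj act).
Variables (g : G) (L : nat) (A : nat -> V).
Hypothesis A_ray : periodic_ray adj act g L A.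

Lemma ray_shift_iter j i : A (j * L + i)%N = act (g ^+ j)%g (A i).
Proof.
elim: j => [|j IHj]; first by rewrite expg0 (act_one actT).
by rewrite mulSn -addnA addnC (ray_shift A_ray) IHj expgS (act_mul actT).
Qed.

(** A fundamental domain of the axis, from the middle of its first edge to the
    middle of the translate of this edge: both of these edges are included, and
    this gives [L] turns. *)
Definition segment_of_ray : seq V := map A (iota 0 L.+2).

Definition ray_turn i := (A i, A i.+1, A i.+2).

Lemma turns_ray m n : turns (map A (iota m n)) = map ray_turn (iota m (n - 2)).
Proof. by rewrite turns_map turns_iota -map_comp. Qed.

Lemma size_segment_of_ray : (2 < size segment_of_ray)%N.
Proof. by rewrite size_map size_iota !ltnS (period_gt0 A_ray). Qed.

Lemma turns_act_segment k : turns (map (act k) segment_of_ray) =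
  [seq (act k (A i), act k (A i.+1), act k (A i.+2)) | i <- iota 0 L].
Proof. by rewrite turns_map turns_ray -map_comp !subSS subn0. Qed.

Lemma packs_ray j m :
  packs (is_copy act segment_of_ray) (map ray_turn (iota (j * L) (m * L))) m.
Proof.
elim: m j => [|m IHm] j; first exact: packs_nil.
rewrite mulSn iotaD map_cat -mulSnr; apply: packs_take => //.
exists (g ^+ j)%g; rewrite turns_act_segment.
rewrite -[in LHS](addn0 (j * L)%N) iotaDl -map_comp.
apply: eq_map => i /=; rewrite /ray_turn -!addnS.
by rewrite -!ray_shift_iter.
Qed.

(** The [n] translates that cover the path from [A 0] to [A (n * L)] reach half
    an edge beyond its end, so the last one does not count. *)
Lemma copies_ray n :
  (n.-1 <= copies act segment_of_ray (map A (iota 0 (n * L).+1)))%N.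
Proof.
case: n => [//|n]; rewrite [n.+1.-1]/=.
apply: (packing_max (is_copy_nonempty size_segment_of_ray)).
have L_gt0 := period_gt0 A_ray.
rewrite turns_ray (_ : (_ - 2)%N = n * L + L.-1)%N; last by rewrite mulSn; lia.
rewrite iotaD map_cat -[n in packs _ _ n]addn0.
by apply: packs_cat (packs0 _ _); apply: (packs_ray 0).
Qed.

(** Suppose that the translate by [k] of the fundamental domain lies reversed
    on the ray. Then [k] maps the edge [A L, A L.+1] to an edge [A m.+1, A m] of
    the ray, and [A 0, A 1] to the translate by [g] of the latter. So
    [g * k^-1 * g * k] takes [A L, A L.+1] to [A m.+1, A m], on to the
    translate of this edge by [g], back to [A 0, A 1], and finally to
    [A L, A L.+1]. *)
Lemma reversed_copy N : well_aligned R adj act g ->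
  copies act segment_of_ray (rev (map A (iota 0 N))) = 0%N.
Proof.
case=> _ aligned; apply/eqP; rewrite -leqn0 leqNgt; apply/negP=> gt0.
have L_gt0 := period_gt0 A_ray.
have [a [u [b [E [k Eu]]]]] := packs_factor (packing_packs _ _) gt0.
have d := ray_turn 0.
have size_u : size u = L by rewrite Eu turns_act_segment size_map size_iota.
have sizes : (size a + (L + size b) = N - 2)%N.
  move/(congr1 size): E.
  by rewrite size_turns size_rev size_map size_iota !size_cat size_u => <-.
have turn q : (q < L)%N -> let s := (N - 2 - (size a + q).+1)%N in
    (act k (A q), act k (A q.+1), act k (A q.+2)) = (A s.+2, A s.+1, A s).
  move=> lt_q s.
  have := congr1 (nth d ^~ (size a + q)%N) E.
  rewrite nth_cat ltnNge leq_addr addKn nth_cat size_u lt_q.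
  rewrite Eu turns_act_segment (nth_map 0%N) ?size_iota // nth_iota //.
  rewrite add0n /= => <-.
  rewrite turns_rev turns_ray -map_comp nth_rev size_map size_iota; last by lia.
  by rewrite (nth_map 0%N) ?size_iota ?nth_iota ?add0n //; lia.
have [e0 e1 _] := turn 0%N L_gt0.
have := turn L.-1; rewrite prednK // => /(_ (leqnn _)) [_ e2 e3].
set m := (N - 2 - (size a + L.-1).+1)%N in e2 e3.
have Em : (N - 2 - (size a + 0).+1 = m + L.-1)%N by rewrite /m; lia.
rewrite {}Em in e0 e1.
have {}e0 : act k (A 0) = A (m.+1 + L)%N by rewrite e0; congr A; lia.
have {}e1 : act k (A 1) = A (m + L)%N by rewrite e1; congr A; lia.
apply: aligned; exists k^-1%g, (A L), (A L.+1); split.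
  exact: (edge_of_axis_ray R treeT actT A_ray).
rewrite invgK; split; rewrite !(act_mul actT).
  by rewrite e2 -(ray_shift A_ray) -e0 (actK actT) -(ray_shift A_ray).
by rewrite e3 -(ray_shift A_ray) -e1 (actK actT) -(ray_shift A_ray).
Qed.

Lemma counting_power n : well_aligned R adj act g ->
  n.-1%:Z <= counting act treeT segment_of_ray (A 0) (g ^+ n)%g.
Proof.
move=> wa; rewrite /counting /signed_between -ray_shift_iter addn0.
have := ray_geodesic treeT (ray_adj A_ray) (ray_nonbacktracking A_ray) 0 (n * L).
move/(geo_eq treeT) ->; rewrite /signed_copies reversed_copy // subr0.
exact: copies_ray.
Qed.

End Power.

(** * Stable commutator length *)

Section CommutatorLength.
Variables (R : realType) (G : groupType).
Implicit Types x y : G.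

Lemma commutator_productM x y m n : commutator_product x m ->
  commutator_product y n -> commutator_product (x * y)%g (m + n).
Proof.
case=> s [<- ->] [t [<- ->]]; exists (s ++ t); split; first by rewrite size_cat.
by rewrite big_cat.
Qed.

Lemma commutator_productX x m n :
  commutator_product x m -> commutator_product (x ^+ n)%g (n * m).
Proof.
move=> cx; elim: n => [|n IHn]; first by exists [::]; rewrite big_nil expg0.
by rewrite expgS mulSn; apply: commutator_productM.
Qed.

Lemma leastP (P : nat -> Prop) n : P n -> P (least P) /\ (least P <= n)%N.
Proof.
move=> Pn; rewrite /least; case: pselect => [e|[]]; last first.
  by exists n; apply/asboolP.
by case: ex_minnP => m /asboolP Pm minm; split=> //; apply/minm/asboolP.
Qed.

Lemma cl_commutator_product x : derived x -> commutator_product x (cl x).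
Proof. by case=> n /leastP []. Qed.

Lemma cl_le x n : commutator_product x n -> (cl x <= n)%N.
Proof. by case/leastP. Qed.

Lemma derivedX x n : derived x -> derived (x ^+ n)%g.
Proof. by case=> m /(commutator_productX n) cx; exists (n * m)%N. Qed.

Lemma cl_powerD x m n : derived x ->
  (cl (x ^+ (m + n)) <= cl (x ^+ m) + cl (x ^+ n))%N.
Proof.
move=> dx; apply: cl_le; rewrite expgnDr.
by apply: commutator_productM; apply/cl_commutator_product/derivedX.
Qed.

(** Fekete's lemma: the limit is the infimum of the quotients. If [u k / k] is
    close to it, then division of [n] by [k] with remainder shows that
    [u n / n] is at most [u k / k + C / n], where [C] depends on [k] only. *)
Lemma subadditive_cvg (u : nat -> R) : (forall n, 0 <= u n) ->
  (forall m n, u (m + n)%N <= u m + u n) -> cvgn (fun n => u n / n%:R).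
Proof.
move=> u0 uD; pose E := [set u n.+1 / n.+1%:R | n in setT]%classic.
have lbE : lbound E 0 by move=> _ [n _ <-]; apply: divr_ge0.
have uM k q r : u (q * k + r)%N <= q%:R * u k + r%:R * u 1%N + u 0%N.
  elim: q => [|q IHq].
    rewrite mul0n add0n mul0r add0r.
    elim: r => [|r IHr]; first by rewrite mul0r add0r.
    by rewrite -add1n natrD mulrDl mul1r -addrA (le_trans (uD _ _)) // lerD2l.
  rewrite mulSn -addnA (le_trans (uD _ _)) // -add1n natrD mulrDl mul1r.
  rewrite -!addrA lerD2l.
  by rewrite addrA.
apply: (@cvgP _ _ (inf E)); apply/cvgrPdist_le => /= e e0.
have e2 : 0 < e / 2 by rewrite divr_gt0.
have hE : has_inf E by split; [exists (u 1%N / 1%:R), 0%N | exists 0].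
have [_ [k _ <-] ltk] := inf_adherent e2 hE.
pose C := k.+1%:R * u 1%N + u 0%N.
near=> n.
have n_gt0 : (0 < n)%N by near: n; apply: nbhs_infty_gt.
have nR : (0 : R) < n%:R by rewrite ltr0n.
have lower : inf E <= u n / n%:R.
  by apply: ge_inf; [exists 0 | exists n.-1; rewrite ?prednK].
rewrite distrC ger0_norm ?subr_ge0 // lerBlDl ler_pdivrMr //.
have Cn : C <= e / 2 * n%:R.
  rewrite -ler_pdivrMl // mulrC; near: n; exact: nbhs_infty_ger.
have := uM k.+1 (n %/ k.+1)%N (n %% k.+1)%N; rewrite -divn_eq => le_un.
apply: (le_trans le_un); rewrite -addrA.
have rC : (n %% k.+1)%:R * u 1%N + u 0%N <= C.
  by rewrite lerD2r ler_wpM2r // ler_nat ltnW // ltn_pmod.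
have qk : (n %/ k.+1)%:R * u k.+1 <= (inf E + e / 2) * n%:R.
  apply: (@le_trans _ _ (u k.+1 / k.+1%:R * n%:R)).
    rewrite -mulrA mulrC ler_wpM2l // mulrC ler_pdivlMr ?ltr0n // -natrM ler_nat.
    exact: leq_divM.
  by rewrite ler_wpM2r ?ltW // ltW.
apply: (le_trans (lerD qk (le_trans rC Cn))).
by rewrite -mulrDl -addrA -splitr.
Unshelve. all: by end_near. Qed.

Lemma scl_derived_ge x (b : R) : derived x ->
  (forall n, b * n%:R <= (cl (x ^+ n)%g)%:R) -> b <= scl_derived R x.
Proof.
move=> dx ge_b; apply: limr_ge.
  apply: (@subadditive_cvg (fun n => (cl (x ^+ n)%g)%:R)) => // m n.
  by rewrite -natrD ler_nat cl_powerD.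
near=> n; have n_gt0 : (0 < n)%N by near: n; apply: nbhs_infty_gt.
by rewrite ler_pdivlMr ?ltr0n.
Unshelve. all: by end_near. Qed.

Lemma scl_ge x (b : R) :
  (forall n m, commutator_product (x ^+ n)%g m -> b * n%:R <= m%:R) ->
  (b%:E <= scl R x)%E.
Proof.
move=> ge_b; rewrite /scl.
case: (pselect (exists k, derived_power x k)) => [ed|nd] /=; last exact: leey.
have [k dk] := ed; have [[k_gt0 {}dk] _] := leastP dk.
set j := least _ in k_gt0 dk *; rewrite lee_fin ler_pdivlMr ?ltr0n //.
apply: scl_derived_ge => // n; rewrite -mulrA -natrM -expgnA.
by apply/ge_b/cl_commutator_product; rewrite expgnA; apply: derivedX.
Qed.

End CommutatorLength.

Theorem theorem6p9 (R : realType) (G : groupType) (V : eqType) (adj : rel V)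
    (act : G -> V -> V) (treeT : is_tree adj)
    (actT : is_tree_action adj act) (noinv : without_inversions adj act)
    (g : G) (wa : well_aligned R adj act g) :
  ((1 / 12)%:E <= scl R g)%E.
Proof.
have nofix v : act g v <> v :=
  hyperbolic_no_fixed_vertex actT (proj1 wa).
have [L [A A_ray]] := periodic_ray_exists treeT actT noinv nofix.
apply: scl_ge => n m cnm.
(* The exponent 5 is large enough for the additive constants 1 and 3 to
   disappear by integrality: [n * 5 - 1 <= 12 * (5 * m) + 3]. *)
have c5 := commutator_productX 5 cnm; rewrite -expgnA in c5.
have upper := counting_commutator_product treeT actT
  (size_segment_of_ray A_ray) (A 0%N) c5.
have lower := counting_power treeT actT A_ray (n * 5) wa.
have le_n : (n <= 12 * m)%N.
  by have := le_trans lower (le_trans (ler_norm _) upper); lia.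
have : (n%:R : R) <= (12 * m)%:R by rewrite ler_nat.
rewrite natrM; lra.
Qed.
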